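(* Let $d\ge 1$ be an integer. For every function $f \in \mathcal{F}$, all density matrices $\rho, \sigma \in \mathcal{D}(\mathbb{C}^d)$, and every $a \in [0,1]$, $$ f(\rho \boxplus_a \sigma) \ \ge\ a\, f(\rho) + (1-a)\, f(\sigma). $$
   Context: $\mathcal{D}(\mathbb{C}^d)$ is the set of density matrices on $\mathbb{C}^d$, i.e. $d\times d$ complex positive semidefinite matrices of trace $1$. For $\rho\in\mathcal{D}(\mathbb{C}^d)$, $\lambda(\rho)=(\lambda_1(\rho),\dots,\lambda_d(\rho))$ denotes the vector of eigenvalues (with multiplicity) in non-increasing order. Addition rule: for $a\in[0,1]$ and $\rho,\sigma\in\mathcal{D}(\mathbb{C}^d)$, $$\rho \boxplus_a \sigma := a\rho + (1-a)\sigma - \sqrt{a(1-a)}\; i[\rho,\sigma], \qquad [\rho,\sigma]:=\rho\sigma-\sigma\rho .$$ This is again a density matrix: it equals $\operatorname{Tr}_2\big(U_a(\rho\otimes\sigma)U_a^\dagger\big)$, where $U_a=\sqrt a\, I+i\sqrt{1-a}\,S$ and $S$ is the swap operator on $\mathbb{C}^d\otimes\mathbb{C}^d$. $\mathcal{F}$ is the class of functions $f:\mathcal{D}(\mathbb{C}^d)\to\mathbb{R}$ such that: (1) (concavity) $f(t\rho+(1-t)\sigma)\ge t f(\rho)+(1-t)f(\sigma)$ for all $\rho,\sigma\in\mathcal{D}(\mathbb{C}^d)$ and $t\in[0,1]$; (2) (symmetry) there is a symmetric (permutation-invariant) function $\phi_f:\mathbb{R}^d\to\mathbb{R}$ with $f(\rho)=\phi_f(\lambda(\rho))$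 for all $\rho$. *)

(* Defs.v *)
(* The reals are an arbitrary [R : realType], the complex numbers are [R[i]]. *)
From mathcomp Require Export all_boot all_order all_algebra all_fingroup.
From mathcomp Require Export complex.
From mathcomp Require Export reals.

Set Implicit Arguments.
Unset Strict Implicit.
Unset Printing Implicit Defensive.

Import Order.TTheory GRing.Theory Num.Theory.

Local Open Scope ring_scope.
Local Open Scope sesquilinear_scope.
Local Open Scope complex_scope.

(* The order on [R[i]] is partial: [0 <= z] says that [z] is real and
   nonnegative. *)
Definition psdmx (R : realType) (d : nat) (A : 'M[R[i]]_d) : Prop :=
  A \is hermsymmx /\ forall v : 'cV[R[i]]_d, 0 <= (v ^t* *m A *m v) 0 0.

Definition density (R : realType) (d : nat) (rho : 'M[R[i]]_d) : Prop :=
  psdmx rho /\ \tr rho = 1.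

Definition char_roots (R : realType) (d : nat) (A : 'M[R[i]]_d) : seq R[i] :=
  sval (closed_field_poly_normal (char_poly A)).

(* The eigenvalues of a Hermitian matrix are real, so that [complex.Re] loses
   no information there. *)
Definition eigvals (R : realType) (d : nat) (A : 'M[R[i]]_d) : 'rV[R]_d :=
  \row_(j < d) (sort >=%R [seq complex.Re z | z <- char_roots A])`_j.

Definition commutator (R : realType) (d : nat) (A B : 'M[R[i]]_d) : 'M[R[i]]_d :=
  A *m B - B *m A.

Definition boxplus (R : realType) (d : nat) (a : R) (rho sigma : 'M[R[i]]_d) :
    'M[R[i]]_d :=
  a%:C *: rho + (1 - a)%:C *: sigma
  - (Num.sqrt (a * (1 - a)))%:C *: ((0 +i* 1) *: commutator rho sigma).

(* A function on density matrices is represented by a total function on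
   matrices, all of whose properties are only required on density matrices. *)
Definition concave_on_density (R : realType) (d : nat) (f : 'M[R[i]]_d -> R) :
    Prop :=
  forall (rho sigma : 'M[R[i]]_d) (t : R),
    density rho -> density sigma -> 0 <= t <= 1 ->
    t * f rho + (1 - t) * f sigma <= f (t%:C *: rho + (1 - t)%:C *: sigma).

Definition symmetric_fun (R : realType) (d : nat) (phi : 'rV[R]_d -> R) : Prop :=
  forall (s : 'S_d) (x : 'rV[R]_d), phi (col_perm s x) = phi x.

Definition symmetric_on_density (R : realType) (d : nat)
    (f : 'M[R[i]]_d -> R) : Prop :=
  exists phi : 'rV[R]_d -> R, symmetric_fun phi /\
    forall rho : 'M[R[i]]_d, density rho -> f rho = phi (eigvals rho).

Definition classF (R : realType) (d : nat) (f : 'M[R[i]]_d -> R) : Prop :=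
  concave_on_density f /\ symmetric_on_density f.

(* Main.v *)
Require Import Defs.
From mathcomp Require Import ring lra.

(* Since [f] is a concave symmetric function of the spectrum, it is enough that
   the spectrum of the boxplus is majorized by [a lambda(rho) + (1 - a)
   lambda(sigma)]. Let [E] be a spectral projector of rank [k] of the boxplus,
   and put [spread E A := tr (E A (1 - E) A)]. Completing a square in
   [E rho (1 - E)] and [E sigma (1 - E)], the commutator term of
   [tr (E (boxplus a rho sigma))] is at most
   [a spread E rho + (1 - a) spread E sigma]. Moreover, for [0 <= A <= 1], even
   [tr (E A) + spread E A] is at most the sum of the [k] largest eigenvalues of
   [A]. *)

Set Implicit Arguments.
Unset Strict Implicit.
Unset Printing Implicit Defensive.

Import Order.TTheory GRing.Theory Num.Theory.
Local Open Scope ring_scope.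
Local Open Scope sesquilinear_scope.

(** * Majorization and convex hulls of permuted vectors *)

(** Partial sums run in index order, without sorting. For nonincreasing [x] this still implies the
    usual majorization, since sorting [y] can only raise its partial sums; the iterates in
    [majorized_hull] may therefore be unsorted. *)
Definition majorized (R : realFieldType) (d : nat) (x y : 'rV[R]_d) : Prop :=
  (forall k : 'I_d,
     \sum_(i < d | (i <= k)%N) x 0 i <= \sum_(i < d | (i <= k)%N) y 0 i) /\
  \sum_i x 0 i = \sum_i y 0 i.

Lemma sum_shift_mass (R : pzRingType) (d : nat) (P : pred 'I_d) (y : 'I_d -> R)
    (e : R) (j k : 'I_d) :
  \sum_(i < d | P i) (y i - e *+ (i == j) + e *+ (i == k)) =
  \sum_(i < d | P i) y i - e *+ P j + e *+ P k.
Proof.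
have delta l : \sum_(i < d | P i) e *+ (i == l) = e *+ P l.
  rewrite big_mkcond (bigD1 l) //= eqxx big1 ?addr0; first by case: (P l).
  by move=> i /negbTE ->; rewrite mulr0n if_same.
by rewrite big_split /= big_split /= sumrN !delta.
Qed.

(* Each step moves mass [e] from an index [j] with [x_j < y_j] to the first
   index [k] with [y_k < x_k]; this averages [y] with its transposition and
   makes one more coordinate of [y] agree with [x]. *)
Lemma majorized_hull (R : realFieldType) (d : nat) (Q : 'rV[R]_d -> Prop)
    (Qperm : forall (s : 'S_d) z, Q z -> Q (col_perm s z))
    (Qconv : forall (t : R) z w, 0 <= t <= 1 -> Q z -> Q w ->
       Q (t *: z + (1 - t) *: w))
    (x y : 'rV[R]_d) (xdec : forall i j : 'I_d, (i <= j)%N -> x 0 j <= x 0 i) :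
  majorized x y -> Q y -> Q x.
Proof.
have [n] := ubnP #|[pred i | x 0 i != y 0 i]|.
elim: n y => // n IHn y ltn [pre tot] Qy.
have [k0 xy_k0|le_xy] := pickP [pred i | y 0 i < x 0 i]; last first.
  (* Here [x <= y] everywhere, and equal totals force equality. *)
  suff -> : x = y by [].
  apply/rowP => i; apply/eqP; rewrite eq_sym -subr_eq0.
  have : \sum_i (y 0 i - x 0 i) == 0 by rewrite sumrB tot subrr.
  rewrite psumr_eq0 => [/allP /(_ i)|l _].
    by rewrite mem_index_enum => /(_ isT).
  by rewrite subr_ge0 leNgt; have /= -> := le_xy l.
have [k /= xy_k kmin] := arg_minnP (fun i : 'I_d => i : nat) xy_k0.
have le_xy (i : 'I_d) : (i < k)%N -> x 0 i <= y 0 i.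
  by move=> ik; rewrite leNgt; apply/negP => /kmin; rewrite leqNgt ik.
have [j /= /andP[jk xy_j]|noj] :=
    pickP [pred j : 'I_d | (j < k)%N && (x 0 j < y 0 j)]; last first.
  (* If [y <= x] before [k], then [y_k < x_k] contradicts the partial sum condition at [k]. *)
  have := pre k; rewrite leNgt => /negP[].
  rewrite (bigD1 k) //= [ltRHS](bigD1 k) //= ltr_leD // ler_sum // => i.
  move=> /andP[ik nik]; have {}ik : (i < k)%N by rewrite ltn_neqAle ik andbT.
  by rewrite leNgt; apply/negP => xyi; have := noj i; rewrite /= ik xyi.
have xkj : x 0 k <= x 0 j by apply/xdec/ltnW.
have njk : (j == k) = false by apply/eqP => ejk; rewrite ejk ltnn in jk.
(* The largest transfer that overshoots neither [x_j] nor [x_k]; whichever term attains the minimum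
   gives the new agreeing coordinate. *)
pose e := Num.min (y 0 j - x 0 j) (x 0 k - y 0 k).
have e0 : 0 <= e by rewrite /e le_min !subr_ge0 !ltW.
have ej : e <= y 0 j - x 0 j by rewrite /e ge_min lexx.
have ek : e <= x 0 k - y 0 k by rewrite /e ge_min lexx orbT.
pose z : 'rV_d := \row_i (y 0 i - e *+ (i == j) + e *+ (i == k)).
apply: (IHn z).
- rewrite -ltnS; apply: leq_trans ltn; rewrite ltnS.
  have sub : [pred i | x 0 i != z 0 i] \subset [pred i | x 0 i != y 0 i].
    apply/subsetP => i; rewrite !inE mxE; apply: contra => /eqP xi.
    have [ij|nij] := eqVneq i j; first by move: xy_j; rewrite -ij xi ltxx.
    have [ik|nik] := eqVneq i k; first by move: xy_k; rewrite -ik xi ltxx.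
    by rewrite subr0 addr0 xi.
  apply: proper_card; apply/properP; split => //.
  have [le|lt] := leP (y 0 j - x 0 j) (x 0 k - y 0 k).
    exists j; first by rewrite inE lt_eqF.
    by rewrite !inE mxE eqxx njk /e min_l // mulr0n mulr1n negbK; apply/eqP; ring.
  exists k; first by rewrite inE gt_eqF.
  rewrite !inE mxE eqxx (eq_sym k) njk /e min_r ?ltW // mulr0n mulr1n negbK.
  by apply/eqP; ring.
- split=> [m|]; last first.
    under [RHS]eq_bigr do rewrite mxE.
    by rewrite sum_shift_mass subrK.
  under [leRHS]eq_bigr do rewrite mxE.
  rewrite sum_shift_mass /=.
  have [km|mk] := leqP k m.
    by rewrite (leq_trans (ltnW jk) km) subrK.
  have [jm|mj] := leqP j m; last by rewrite subr0 addr0.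
  (* For [j <= m < k] the partial sum loses [e]. The slack at [j] alone pays for it, because
     [x <= y] at every index before [k]. *)
  rewrite mulr1n addr0 lerBrDr -lerBrDl -sumrB (bigD1 j) //=.
  rewrite ler_wpDr // sumr_ge0 // => i /andP[im _]; rewrite subr_ge0.
  exact/le_xy/(leq_ltn_trans im).
- have yjk : 0 < y 0 j - y 0 k by lra.
  (* The weight for which averaging with the transposition moves exactly [e]. It is nonnegative
     since [e <= x_k - y_k] and [x_k <= x_j < y_j]. *)
  pose t := 1 - e / (y 0 j - y 0 k).
  have tE : (1 - t) * (y 0 j - y 0 k) = e by rewrite /t opprB addrC subrK divfK ?gt_eqF.
  have -> : z = t *: y + (1 - t) *: col_perm (tperm j k) y.
    apply/rowP => i; rewrite !mxE; case: tpermP => [->|->|/eqP nij /eqP nik].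
    - by rewrite eqxx njk -tE /=; ring.
    - by rewrite eqxx (eq_sym k) njk -tE /=; ring.
    - by rewrite (negbTE nij) (negbTE nik) /=; ring.
  apply: Qconv => //; last exact: Qperm.
  rewrite /t subr_ge0 lerBlDr lerDl divr_ge0 ?(ltW yjk) // andbT.
  by rewrite ler_pdivrMr // mul1r; lra.
Qed.

(** * Weighted sums against leading partial sums *)

Lemma sum_ord_leq (R : pzSemiRingType) (d : nat) (k : 'I_d) :
  \sum_(i < d) (i <= k)%N%:R = k.+1%:R :> R.
Proof.
rewrite -natr_sum; congr _%:R.
by rewrite -big_mkcond /= (big_ord_narrow (ltn_ord k)) sum1_card card_ord.
Qed.

(** The bathtub principle. The weights [q] and the indicator of [i <= k] have the same total, so
    [x k] can be subtracted from each [x i]; the two factors of every resulting term then have the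
    same sign. *)
Lemma sum_le_head_sum (R : numDomainType) (d : nat) (x q : 'I_d -> R) (k : 'I_d)
    (xdec : forall i j : 'I_d, (i <= j)%N -> x j <= x i)
    (q01 : forall i, 0 <= q i <= 1) (qsum : \sum_i q i = k.+1%:R) :
  \sum_i x i * q i <= \sum_(i < d | (i <= k)%N) x i.
Proof.
have cnt := sum_ord_leq R k.
rewrite [leRHS]big_mkcond -subr_ge0 -sumrB.
have -> : \sum_(i < d) ((if (i <= k)%N then x i else 0) - x i * q i) =
    \sum_(i < d) (x i - x k) * ((i <= k)%N%:R - q i).
  rewrite -[LHS]addr0 -[X in _ + X](mulr0 (- x k)).
  rewrite -[X in _ * X](subrr k.+1%:R) -{1}cnt -qsum -sumrB mulr_sumr -big_split.
  by apply: eq_bigr => i _; case: leqP => _ /=; ring.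
apply: sumr_ge0 => i _; have /andP[q0 q1] := q01 i; case: leqP => ik /=.
  by rewrite mulr_ge0 ?subr_ge0 // xdec.
by rewrite mulr_le0 ?subr_le0 // xdec // ltnW.
Qed.

(** Each double sum is added to its copy with the indices exchanged, so only symmetrized summands
    need comparing. *)
Lemma ler_sum_swap (R : numDomainType) (I : finType) (F G : I -> I -> R) :
  (forall i j, F i j + F j i <= G i j + G j i) ->
  \sum_i \sum_j F i j <= \sum_i \sum_j G i j.
Proof.
move=> leFG; rewrite -(ler_pMn2r (ltn0Sn 1)) !mulr2n.
rewrite {2}exchange_big [X in _ <= _ + X]exchange_big -!big_split /=.
by apply: ler_sum => i _; rewrite -!big_split /=; apply: ler_sum => j _.
Qed.

(* The summand [x_i^2 S_ij - x_i x_j S_ij] symmetrizes to [S_ij (x_i - x_j)^2], which is at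
   most [S_ij |x_i - x_j|]. This makes the left-hand side at most
   [\sum_i x_i q_i] with the weights [q_i] below. *)
Lemma sum_spread_le_head_sum (R : numDomainType) (d : nat) (x p : 'I_d -> R)
    (S : 'I_d -> 'I_d -> R) (k : 'I_d)
    (xdec : forall i j : 'I_d, (i <= j)%N -> x j <= x i)
    (x01 : forall i, 0 <= x i <= 1)
    (S0 : forall i j, 0 <= S i j) (Ssym : forall i j, S i j = S j i)
    (Sdiag : forall i, S i i = p i ^+ 2) (pE : forall i, p i = \sum_j S i j)
    (psum : \sum_i p i = k.+1%:R) :
  \sum_i x i * p i + (\sum_i x i ^+ 2 * p i - \sum_i \sum_j x i * x j * S i j)
    <= \sum_(i < d | (i <= k)%N) x i.
Proof.
(* The sign of [j - i]. As [x] is nonincreasing, [s i j * (x i - x j)] is [|x i - x j|];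
   antisymmetry of [s] leaves the total of the weights [q] unchanged. *)
pose s (i j : 'I_d) : R := (i < j)%N%:R - (j < i)%N%:R.
have sN i j : s i j = - s j i by rewrite /s opprB.
have s1 i j : 0 <= 1 + s i j <= 2.
  rewrite /s; by case: ltngtP => _ /=; rewrite ?subr0 ?sub0r ?subrr ?addr0 ?ler01 ?lexx ?ler0n ?ler1n
    ?ler_nat ?addr_ge0 ?ler01.
pose q i := \sum_j S i j * (1 + s i j).
have qsum : \sum_i q i = k.+1%:R.
  rewrite -psum [RHS](eq_bigr _ (fun i _ => pE i));
  apply/le_anti/andP; split; apply: ler_sum_swap => i j;
    by rewrite (Ssym j i) (sN j i) le_eqVlt; apply/orP; left; apply/eqP; ring.
have q01 i : 0 <= q i <= 1.
  apply/andP; split.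
    by apply: sumr_ge0 => j _; rewrite mulr_ge0 //; have /andP[] := s1 i j.
  (* The factor [1 + s i j] is 1 on the diagonal and at most 2 elsewhere, so [q i] is at most
     [2 p_i - p_i^2 = 1 - (1 - p_i)^2]. *)
  apply: (@le_trans _ _ (p i *+ 2 - p i ^+ 2)).
    have pi : p i = p i ^+ 2 + \sum_(j | j != i) S i j.
      by rewrite {1}pE (bigD1 i) //= Sdiag.
    rewrite /q (bigD1 i) //= /s ltnn subrr addr0 mulr1 Sdiag {2}pi.
    rewrite mulrnDl [_ ^+ 2 *+ 2]mulr2n addrAC addrK lerD2l -sumrMnl.
    apply: ler_sum => j _.
    by rewrite -[leRHS]mulr_natr ler_wpM2l //; have /andP[] := s1 i j.
  have pr : 1 - p i \is Num.real.
    by rewrite rpredB ?rpred1 // ger0_real // pE sumr_ge0.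
  rewrite -subr_ge0; suff -> : 1 - (p i *+ 2 - p i ^+ 2) = (1 - p i) ^+ 2.
    by rewrite real_exprn_even_ge0.
  by ring.
apply: le_trans (sum_le_head_sum xdec q01 qsum).
suff : \sum_i x i ^+ 2 * p i - \sum_i \sum_j x i * x j * S i j
       <= \sum_i \sum_j x i * (S i j * s i j).
  rewrite -(lerD2l (\sum_i x i * p i)) => /le_trans; apply.
  rewrite -big_split ler_sum // => i _ /=.
  rewrite pE /q !mulr_sumr -big_split ler_sum // => j _ /=.
  by rewrite le_eqVlt; apply/orP; left; apply/eqP; ring.
have -> : \sum_i x i ^+ 2 * p i - \sum_i \sum_j x i * x j * S i j =
          \sum_i \sum_j (x i ^+ 2 * S i j - x i * x j * S i j).
  rewrite -sumrB; apply: eq_bigr => i _.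
  by rewrite pE mulr_sumr -sumrB.
apply: ler_sum_swap => i j; rewrite (Ssym j i) (sN j i).
have -> : x i ^+ 2 * S i j - x i * x j * S i j + (x j ^+ 2 * S i j - x j * x i * S i j)
  = S i j * (x i - x j) ^+ 2 by ring.
have -> : x i * (S i j * s i j) + x j * (S i j * - s i j) = S i j * (s i j * (x i - x j)).
  by ring.
rewrite ler_wpM2l //.
have sq u v : 0 <= u <= 1 -> 0 <= v <= 1 -> v <= u -> (u - v) ^+ 2 <= u - v.
  move=> /andP[u0 u1] /andP[v0 v1] vu.
  rewrite expr2 ler_piMl ?subr_ge0 //.
  by rewrite lerBlDr (le_trans u1) // lerDl.
rewrite /s; case: ltngtP => ij /=.
- by rewrite subr0 mul1r sq // xdec // ltnW.
- by rewrite sub0r mulN1r opprB -sqrrN opprB sq // xdec // ltnW.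
- by rewrite (val_inj ij) !subrr expr0n mulr0.
Qed.

(** * Orthogonal projectors and the spread *)

Lemma trmxC_mul (C : numClosedFieldType) (m n p : nat) (A : 'M[C]_(m, n))
    (B : 'M[C]_(n, p)) :
  (A *m B) ^t* = B ^t* *m A ^t*.
Proof. by rewrite trmx_mul map_mxM. Qed.

Lemma mxtrace_mulmxtC_ge0 (C : numClosedFieldType) (m n : nat) (A : 'M[C]_(m, n)) :
  0 <= \tr (A *m A ^t*).
Proof.
apply: sumr_ge0 => i _; rewrite mxE; apply: sumr_ge0 => j _.
by rewrite !mxE mul_conjC_ge0.
Qed.

Definition ortho_projector (C : numClosedFieldType) (d : nat) (E : 'M[C]_d) : Prop :=
  E ^t* = E /\ E *m E = E.

(** For an orthogonal projector [E] and Hermitian [A], the squared Hilbert-Schmidt norm of the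
    off-diagonal block [E A (1 - E)]. *)
Definition spread (C : numClosedFieldType) (d : nat) (E A : 'M[C]_d) : C :=
  \tr (E *m A *m (1%:M - E) *m A).

Lemma ortho_projectorC (C : numClosedFieldType) (d : nat) (E : 'M[C]_d) :
  ortho_projector E -> ortho_projector (1%:M - E).
Proof.
move=> [Eh EE]; split.
  by rewrite linearB /= raddfB /= Eh trmx1 map_mx1.
by rewrite mulmxBl mul1mx mulmxBr mulmx1 EE subrr subr0.
Qed.

Lemma ortho_projector_conj (C : numClosedFieldType) (d : nat) (U E : 'M[C]_d) :
  U \is unitarymx -> ortho_projector E -> ortho_projector (U *m E *m U ^t*).
Proof.
move=> Uu [Eh EE]; split; first by rewrite !trmxC_mul trmxCK Eh mulmxA.
by rewrite !mulmxA mulmxKtV // -(mulmxA U E E) EE.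
Qed.

Lemma spread_conj (C : numClosedFieldType) (d : nat) (U E A : 'M[C]_d) :
  U \is unitarymx -> spread E (U ^t* *m A *m U) = spread (U *m E *m U ^t*) A.
Proof.
move=> Uu; rewrite /spread.
have -> : 1%:M - U *m E *m U ^t* = U *m (1%:M - E) *m U ^t*.
  by rewrite mulmxBr mulmx1 mulmxBl (unitarymxP Uu).
by rewrite -[in RHS](mulmxA U E) -!mulmxA [RHS]mxtrace_mulC !mulmxA.
Qed.

(* The left-hand side is the trace of [X *m X^t* ] for [X = E (r A - j s B) (1 - E)]. *)
Lemma spread_commutator_ge0 (C : numClosedFieldType) (d : nat)
    (E A B : 'M[C]_d) (r s j : C) :
  ortho_projector E -> A ^t* = A -> B ^t* = B ->
  r \is Num.real -> s \is Num.real -> j^* = - j -> j * j = - 1 ->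
  0 <= r ^+ 2 * spread E A + s ^+ 2 * spread E B
       + r * s * j * \tr (E *m (A *m B - B *m A)).
Proof.
move=> hE hA hB /CrealP hr /CrealP hs cj jj.
have [Eh EE] := hE; have [Fh FF] := ortho_projectorC hE.
set F := 1%:M - E in Fh FF.
pose M := r *: A - (j * s) *: B.
have hM : M ^t* = r *: A + (j * s) *: B.
  rewrite -{1}hA -{1}hB; apply/matrixP => i l.
  by rewrite !mxE rmorphB !rmorphM /= hr hs cj !mulNr opprK.
have := mxtrace_mulmxtC_ge0 (E *m M *m F).
rewrite !trmxC_mul Fh Eh hM.
have -> : \tr (E *m M *m F *m (F *m ((r *: A + (j * s) *: B) *m E))) =
          \tr (E *m M *m F *m (r *: A + (j * s) *: B)).
  rewrite -!mulmxA (mulmxA F F) FF mxtrace_mulC -!mulmxA EE.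
  by rewrite !mulmxA [LHS]mxtrace_mulC !mulmxA.
congr (0 <= _).
rewrite /spread -/F /M.
(* The terms [E A E B] and [E B E A] have equal traces by cyclicity and cancel, leaving only
   products of off-diagonal blocks. *)
have -> : \tr (E *m (A *m B - B *m A)) = \tr (E *m A *m F *m B) - \tr (E *m B *m F *m A).
  rewrite /F !mulmxBr !mulmxBl !mulmx1 !raddfB /= !mulmxA.
  rewrite [\tr (E *m B *m E *m A)]mxtrace_mulC !mulmxA.
  rewrite [\tr (A *m E *m B *m E)]mxtrace_mulC !mulmxA; ring.
clearbody F; rewrite !(mulmxBr, mulmxBl, mulmxDr) -!(scalemxAr, scalemxAl).
rewrite !(raddfB, raddfD, raddfN) /= !mxtraceZ.
ring: jj.
Qed.

(** The squared moduli of the entries of [E] serve as [S] in [sum_spread_le_head_sum]: [E] being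
    Hermitian makes them symmetric, and idempotence makes their row sums the diagonal of [E]. *)
Lemma diag_spread_le (C : numClosedFieldType) (d : nat) (E : 'M[C]_d) (x : 'rV[C]_d)
    (k : 'I_d) (hE : ortho_projector E) (trE : \tr E = k.+1%:R)
    (xdec : forall i j : 'I_d, (i <= j)%N -> x 0 j <= x 0 i)
    (x01 : forall i, 0 <= x 0 i <= 1) :
  \tr (E *m diag_mx x) + spread E (diag_mx x) <= \sum_(i < d | (i <= k)%N) x 0 i.
Proof.
have [Eh EE] := hE.
have Eij i j : E j i = (E i j)^* by rewrite -[in LHS]Eh !mxE.
pose S i j := `|E i j| ^+ 2; pose p i := E i i.
have pE i : p i = \sum_j S i j.
  by rewrite /p -[in LHS]EE mxE; apply: eq_bigr => j _; rewrite /S normCK (Eij i j).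
have Ssym i j : S i j = S j i by rewrite /S (Eij i j) norm_conjC.
have S0 i j : 0 <= S i j by rewrite exprn_ge0.
have Sdiag i : S i i = p i ^+ 2 by rewrite /S normCK -Eij.
apply: le_trans (sum_spread_le_head_sum xdec x01 S0 Ssym Sdiag pE trE).
rewrite le_eqVlt; apply/orP; left; apply/eqP; congr (_ + _).
  by rewrite mul_mx_diag; apply: eq_bigr => i _; rewrite mxE mulrC.
rewrite /spread mulmxBr mulmx1 mulmxBl raddfB /=; congr (_ - _).
  rewrite !mul_mx_diag; apply: eq_bigr => i _; rewrite !mxE /p; ring.
rewrite -!mulmxA mulmxA !mul_mx_diag; apply: eq_bigr => i _; rewrite mxE.
apply: eq_bigr => j _; rewrite !mxE /S normCK -(Eij i j); ring.
Qed.

(** * Unitary conjugation and sorting *)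

Lemma mxtrace_unitary_conj (C : numClosedFieldType) (d : nat) (U A : 'M[C]_d) :
  U \is unitarymx -> \tr (U ^t* *m A *m U) = \tr A.
Proof. by move=> Uu; rewrite mxtrace_mulC mulmxA (unitarymxP Uu) mul1mx. Qed.

Lemma mul_unitary_conj (C : numClosedFieldType) (d : nat) (U A B : 'M[C]_d) :
  U \is unitarymx ->
  (U ^t* *m A *m U) *m (U ^t* *m B *m U) = U ^t* *m (A *m B) *m U.
Proof. by move=> Uu; rewrite !mulmxA mulmxtVK. Qed.

Lemma conj_diag_mxE (C : numClosedFieldType) (d : nat) (U : 'M[C]_d) (x : 'rV[C]_d) i j :
  (U ^t* *m diag_mx x *m U) i j = \sum_l (U l i)^* * x 0 l * U l j.
Proof. by rewrite mul_mx_diag mxE; apply: eq_bigr => l _; rewrite !mxE. Qed.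

Lemma char_poly_unitary_conj (C : numClosedFieldType) (d : nat) (U A : 'M[C]_d) :
  U \is unitarymx -> char_poly (U ^t* *m A *m U) = char_poly A.
Proof.
move=> Uu; rewrite /char_poly /char_poly_mx.
have UU : map_mx polyC (U ^t*) *m map_mx polyC U = 1%:M.
  by rewrite -map_mxM -(invmx_unitary Uu) mulVmx ?unitarymx_unit // map_mx1.
have -> : 'X%:M - map_mx polyC (U ^t* *m A *m U) =
    map_mx polyC (U ^t*) *m ('X%:M - map_mx polyC A) *m map_mx polyC U.
  rewrite mulmxBr mulmxBl !map_mxM; congr (_ - _).
  by rewrite scalar_mxC -mulmxA UU mulmx1.
rewrite !det_mulmx mulrC mulrA -det_mulmx.
by rewrite (mulmx1C UU) det1 mul1r.
Qed.

Lemma exists_sorting_perm (R : realDomainType) (d : nat) (s : seq R) (x : 'rV[R]_d) :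
  perm_eq s [seq x 0 i | i : 'I_d] ->
  exists p : 'S_d, \row_i (sort >=%R s)`_i = col_perm p x.
Proof.
move=> sx; have : perm_eq (sort >=%R s) [tuple x 0 i | i < d].
  by rewrite perm_sort.
move=> /tuple_permP[p sE]; exists p; apply/rowP => i.
by rewrite sE !mxE (nth_map i) ?size_enum_ord // nth_ord_enum tnth_mktuple.
Qed.

Lemma sorted_nonincreasing (R : realDomainType) (d : nat) (s : seq R) (i j : 'I_d) :
  size s = d -> (i <= j)%N -> (sort >=%R s)`_j <= (sort >=%R s)`_i.
Proof.
move=> sd ij; apply: (sorted_leq_nth ge_trans ge_refl 0 (sort_sorted ge_total s)) => //;
  by rewrite inE size_sort sd.
Qed.

Local Open Scope complex_scope.

(** * Eigenvalues of Hermitian and density matrices *)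

Definition realdiag (R : realType) (d : nat) (x : 'rV[R]_d) : 'M[R[i]]_d :=
  diag_mx (map_mx (real_complex R) x).

Lemma mxtrace_realdiag (R : realType) (d : nat) (x : 'rV[R]_d) :
  \tr (realdiag x) = (\sum_i x 0 i)%:C.
Proof. by rewrite mxtrace_diag rmorph_sum; apply: eq_bigr => i _; rewrite mxE. Qed.

Lemma trmxC_realdiag (R : realType) (d : nat) (x : 'rV[R]_d) :
  realdiag x ^t* = realdiag x.
Proof.
rewrite tr_diag_mx map_diag_mx; congr diag_mx; apply/rowP => i.
by rewrite !mxE; exact: conjc_real.
Qed.

Lemma trmxC_realdiag_conj (R : realType) (d : nat) (U : 'M[R[i]]_d) (x : 'rV[R]_d) :
  (U ^t* *m realdiag x *m U) ^t* = U ^t* *m realdiag x *m U.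
Proof. by rewrite !trmxC_mul trmxCK trmxC_realdiag mulmxA. Qed.

Lemma hermsymmxP (R : realType) (d : nat) (A : 'M[R[i]]_d) :
  reflect (A ^t* = A) (A \is hermsymmx).
Proof.
by apply: (iffP (is_hermitianmxP _ _ _)); rewrite expr0 scale1r.
Qed.

(** The spectral theorem gives real eigenvalues in no particular order; the sorting permutation is
    applied to them and to the rows of the unitary alike. *)
Lemma hermitian_eigen_decomposition (R : realType) (d : nat) (A : 'M[R[i]]_d) :
  A ^t* = A ->
  exists U : 'M[R[i]]_d, exists x : 'rV[R]_d,
    [/\ U \is unitarymx, A = U ^t* *m realdiag x *m U &
        forall i j : 'I_d, (i <= j)%N -> x 0 j <= x 0 i].
Proof.
move=> /hermsymmxP Ah.
have /orthomx_spectralP := hermitian_normalmx Ah.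
have := hermitian_spectral_diag_real Ah.
have := spectral_unitarymx A.
move: (spectralmx A) (spectral_diag A) => P sp Pu spr.
rewrite (invmx_unitary Pu) => AE.
pose y : 'rV[R]_d := \row_i complex.Re (sp 0 i).
have spE i : sp 0 i = (y 0 i)%:C by rewrite mxE RRe_real //; apply: (mxOverP spr).
pose s := [seq y 0 i | i : 'I_d].
have [p pE] := exists_sorting_perm (perm_refl s).
exists (row_perm p P), (col_perm p y); split.
- apply/unitarymxP/matrixP => i j; rewrite !mxE.
  have /matrixP /(_ (p i) (p j)) := unitarymxP Pu.
  rewrite !mxE (inj_eq perm_inj) => <-.
  by apply: eq_bigr => l _; rewrite !mxE.
- apply/matrixP => i j; rewrite {1}AE !conj_diag_mxE (reindex_inj (@perm_inj _ p)).
  by apply: eq_bigr => l _; rewrite spE !mxE.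
- move=> i j ij; rewrite -pE !mxE; apply: sorted_nonincreasing => //.
  by rewrite size_map size_enum_ord.
Qed.

(** The characteristic polynomial is the product of the factors ['X - x_i], which fixes its roots up
    to order. *)
Lemma eigvals_unitary_diag (R : realType) (d : nat) (U : 'M[R[i]]_d) (x : 'rV[R]_d) :
  U \is unitarymx ->
  exists p : 'S_d, eigvals (U ^t* *m realdiag x *m U) = col_perm p x.
Proof.
move=> Uu; apply: exists_sorting_perm.
rewrite /char_roots; case: closed_field_poly_normal => r /=.
rewrite (monicP (char_poly_monic _)) scale1r char_poly_unitary_conj //.
rewrite char_poly_trig ?diag_mx_is_trig // => rE.
have /(perm_map (@complex.Re R)) : perm_eq r [seq (x 0 i)%:C | i : 'I_d].
  apply: prod_XsubC_eq; rewrite -rE big_map big_enum /=.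
  by apply: eq_bigr => i _; rewrite !mxE eqxx.
by rewrite -map_comp.
Qed.

Lemma density_unitary_diagP (R : realType) (d : nat) (U : 'M[R[i]]_d) (x : 'rV[R]_d) :
  U \is unitarymx ->
  density (U ^t* *m realdiag x *m U) <->
  (forall i, 0 <= x 0 i) /\ \sum_i x 0 i = 1.
Proof.
move=> Uu.
have trE : \tr (U ^t* *m realdiag x *m U) = (\sum_i x 0 i)%:C.
  by rewrite mxtrace_unitary_conj // mxtrace_realdiag.
split=> [[[_ pos] tr1]|[x0 x1]].
  split=> [i|]; last by apply: complexI; rewrite -trE tr1.
  (* At the eigenvector [U ^t* e_i] the quadratic form takes the value [x_i]. *)
  have := pos (U ^t* *m delta_mx i 0).
  rewrite trmxC_mul trmxCK !mulmxA mulmxtVK // -!mulmxA.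
  rewrite (mulmxA U) (unitarymxP Uu) mul1mx !mulmxA.
  by rewrite trmx_delta map_delta_mx -rowE -colE !mxE eqxx mulr1n ler0c.
split; last by rewrite trE x1.
split=> [|v]; first by apply/hermsymmxP; apply: trmxC_realdiag_conj.
have -> : v ^t* *m (U ^t* *m realdiag x *m U) *m v =
   (U *m v) ^t* *m realdiag x *m (U *m v).
  by rewrite trmxC_mul !mulmxA.
rewrite mul_mx_diag mxE sumr_ge0 // => i _; rewrite !mxE.
by rewrite mulrAC mulr_ge0 ?lecR // mulrC mul_conjC_ge0.
Qed.

(** * Trace bounds and majorization for the boxplus *)

Lemma conj_complex_i (R : realType) : (0 +i* 1 : R[i])^*%R = - (0 +i* 1).
Proof. by apply/eqP; rewrite eq_complex /= oppr0 !eqxx. Qed.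

(** Ky Fan's maximum principle, strengthened by the spread. Moving the unitary onto [E] reduces it
    to a diagonal matrix. *)
Lemma head_projector_bound (R : realType) (d : nat) (E U : 'M[R[i]]_d) (x : 'rV[R]_d)
    (k : 'I_d) (hE : ortho_projector E) (trE : \tr E = k.+1%:R)
    (Uu : U \is unitarymx)
    (xdec : forall i j : 'I_d, (i <= j)%N -> x 0 j <= x 0 i)
    (x01 : forall i, 0 <= x 0 i <= 1) :
  \tr (E *m (U ^t* *m realdiag x *m U)) + spread E (U ^t* *m realdiag x *m U)
    <= (\sum_(i < d | (i <= k)%N) x 0 i)%:C.
Proof.
have -> : \tr (E *m (U ^t* *m realdiag x *m U)) = \tr (U *m E *m U ^t* *m realdiag x).
  by rewrite !mulmxA mxtrace_mulC !mulmxA.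
rewrite spread_conj // rmorph_sum.
have -> : \sum_(i < d | (i <= k)%N) (x 0 i)%:C =
    \sum_(i < d | (i <= k)%N) (map_mx (real_complex R) x) 0 i.
  by apply: eq_bigr => i _; rewrite mxE.
apply: diag_spread_le; first exact: ortho_projector_conj.
- by rewrite mxtrace_mulC mulmxA -(invmx_unitary Uu) mulVmx ?unitarymx_unit ?mul1mx.
- by move=> i j ij; rewrite !mxE lecR xdec.
- by move=> i; rewrite mxE ler0c lecR x01.
Qed.

Lemma mxtrace_boxplus (R : realType) (d : nat) (a : R) (A B : 'M[R[i]]_d) :
  \tr (boxplus a A B) = a%:C * \tr A + (1 - a)%:C * \tr B.
Proof.
rewrite /boxplus /commutator [LHS]raddfB [X in X - _]raddfD /= !mxtraceZ.
by rewrite [X in _ * (_ * X)]raddfB /= mxtrace_mulC subrr !mulr0 subr0.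
Qed.

Lemma mxtrace_projector_boxplus (R : realType) (d : nat) (a : R) (E A B : 'M[R[i]]_d)
    (a01 : 0 <= a <= 1) (hE : ortho_projector E) (Ah : A ^t* = A) (Bh : B ^t* = B) :
  \tr (E *m boxplus a A B) <= a%:C * (\tr (E *m A) + spread E A) +
    (1 - a)%:C * (\tr (E *m B) + spread E B).
Proof.
have /andP[a0 a1] := a01; have b0 : 0 <= 1 - a by rewrite subr_ge0.
have jj : (0 +i* 1) * (0 +i* 1) = - 1 :> R[i] by rewrite -expr2 sqr_i.
have Creal (t : R) : t%:C \is Num.real by rewrite complex_real.
(* With [r = sqrt a] and [s = sqrt (1 - a)], the cross term of the completed square is exactly the
   commutator term of [boxplus]. *)
have := spread_commutator_ge0 hE Ah Bh (Creal (Num.sqrt a))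
  (Creal (Num.sqrt (1 - a))) (conj_complex_i R) jj.
rewrite -!rmorphXn /= !sqr_sqrtr // -rmorphM -sqrtrM // -mulrA -/(commutator _ _).
have -> : \tr (E *m boxplus a A B) = a%:C * \tr (E *m A) + (1 - a)%:C * \tr (E *m B) -
    (Num.sqrt (a * (1 - a)))%:C * ((0 +i* 1) * \tr (E *m commutator A B)).
  rewrite /boxplus mulmxBr mulmxDr -!scalemxAr [LHS]raddfB [X in X - _]raddfD /=.
  by rewrite !mxtraceZ.
move: (\tr (E *m A)) (\tr (E *m B)) (\tr (E *m commutator A B)) => tA tB tC.
move: (spread E A) (spread E B) (a%:C) ((1 - a)%:C) (_ %:C) => sA sB u v w.
rewrite -subr_ge0 => key; rewrite -subr_ge0; apply: le_trans key _.
rewrite le_eqVlt; apply/orP; left; apply/eqP; ring.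
Qed.

Lemma boxplus_majorized (R : realType) (d : nat) (U V W : 'M[R[i]]_d)
    (x y z : 'rV[R]_d) (a : R)
    (Uu : U \is unitarymx) (Vu : V \is unitarymx) (Wu : W \is unitarymx)
    (xdec : forall i j : 'I_d, (i <= j)%N -> x 0 j <= x 0 i)
    (ydec : forall i j : 'I_d, (i <= j)%N -> y 0 j <= y 0 i)
    (x01 : forall i, 0 <= x 0 i <= 1) (y01 : forall i, 0 <= y 0 i <= 1)
    (a01 : 0 <= a <= 1) :
  boxplus a (U ^t* *m realdiag x *m U) (V ^t* *m realdiag y *m V) =
    W ^t* *m realdiag z *m W ->
  majorized z (a *: x + (1 - a) *: y).
Proof.
move=> tauE.
have /andP[a0 a1] := a01; have b0 : 0 <= 1 - a by rewrite subr_ge0.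
split=> [k|]; last first.
  apply: complexI; rewrite -mxtrace_realdiag -(mxtrace_unitary_conj _ Wu) -tauE.
  rewrite mxtrace_boxplus (mxtrace_unitary_conj _ Uu) (mxtrace_unitary_conj _ Vu) !mxtrace_realdiag.
  rewrite -!rmorphM -rmorphD !mulr_sumr.
  by rewrite -big_split; congr _%:C; apply: eq_bigr => i _; rewrite !mxE.
(* [E] projects onto the eigenvectors indexed by [0, ..., k], hence has rank [k.+1]; its trace
   against the boxplus is the partial sum of [z]. *)
pose D : 'M[R[i]]_d := diag_mx (\row_i (i <= k)%N%:R).
pose E := W ^t* *m D *m W.
have hD : ortho_projector D.
  split.
    by rewrite tr_diag_mx map_diag_mx; congr diag_mx; apply/rowP => i; rewrite !mxE rmorph_nat.
  rewrite mulmx_diag; congr diag_mx; apply/rowP => i; rewrite !mxE -natrM.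
  by case: (i <= k)%N.
have hE : ortho_projector E.
  have Wtu : W ^t* \is unitarymx by rewrite trmxC_unitary.
  by have := ortho_projector_conj Wtu hD; rewrite trmxCK.
have trE : \tr E = k.+1%:R.
  rewrite /E mxtrace_unitary_conj // mxtrace_diag -[RHS](sum_ord_leq _ k).
  by apply: eq_bigr => i _; rewrite mxE.
have trEz : \tr (E *m boxplus a (U ^t* *m realdiag x *m U) (V ^t* *m realdiag y *m V)) =
    (\sum_(i < d | (i <= k)%N) z 0 i)%:C.
  rewrite tauE mul_unitary_conj // mxtrace_unitary_conj // mulmx_diag mxtrace_diag.
  rewrite rmorph_sum [RHS]big_mkcond /=; apply: eq_bigr => i _; rewrite !mxE.
  by case: leqP => _; rewrite ?mul1r ?mul0r.
rewrite -lecR -trEz.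
have hr := head_projector_bound hE trE Uu xdec x01.
have hs := head_projector_bound hE trE Vu ydec y01.
apply: le_trans (mxtrace_projector_boxplus a01 hE (trmxC_realdiag_conj U x)
  (trmxC_realdiag_conj V y)) _.
have -> : \sum_(i < d | (i <= k)%N) (a *: x + (1 - a) *: y) 0 i =
   a * \sum_(i < d | (i <= k)%N) x 0 i + (1 - a) * \sum_(i < d | (i <= k)%N) y 0 i.
  by rewrite !mulr_sumr -big_split; apply: eq_bigr => i _; rewrite !mxE.
by rewrite [leRHS]rmorphD !rmorphM /= lerD // ler_wpM2l // ler0c.
Qed.

(** The commutator of Hermitian matrices is anti-Hermitian, and the factor [i] makes it
    Hermitian. *)
Lemma trmxC_boxplus (R : realType) (d : nat) (a : R) (A B : 'M[R[i]]_d) :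
  A ^t* = A -> B ^t* = B -> (boxplus a A B) ^t* = boxplus a A B.
Proof.
move=> Ah Bh; rewrite /boxplus /commutator; move: (Num.sqrt _) => s.
have := trmxC_mul A B; have := trmxC_mul B A.
rewrite Ah Bh; move: (A *m B) (B *m A) => AB BA /matrixP BAh /matrixP ABh.
move/matrixP: Ah => Ah; move/matrixP: Bh => Bh.
apply/matrixP => i j.
move: (1 - a) => b; have := Ah i j; have := Bh i j; have := ABh i j; have := BAh i j.
rewrite !mxE rmorphB rmorphD !rmorphM rmorphB /= => -> -> -> ->.
have conjR (t : R) : (t%:C)^*%R = t%:C by exact: conjc_real.
by rewrite (conj_complex_i R) !conjR; ring.
Qed.

(** * From majorization to concave symmetric functions *)

Theorem theorem4 (R : realType) (d : nat) (hd : (1 <= d)%N)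
    (f : 'M[R[i]]_d -> R) (hf : classF f)
    (rho sigma : 'M[R[i]]_d) (hrho : density rho) (hsigma : density sigma)
    (a : R) (ha : 0 <= a <= 1) :
  a * f rho + (1 - a) * f sigma <= f (boxplus a rho sigma).
Proof.
have [fconc [phi [phisym fE]]] := hf.
have [[/hermsymmxP rhoh _] _] := hrho; have [[/hermsymmxP sigmah _] _] := hsigma.
have [U [x [Uu rhoE xdec]]] := hermitian_eigen_decomposition rhoh.
have [V [y [Vu sigmaE ydec]]] := hermitian_eigen_decomposition sigmah.
have [W [z [Wu tauE zdec]]] := hermitian_eigen_decomposition (trmxC_boxplus a rhoh sigmah).
have fphi (X : 'M[R[i]]_d) (w : 'rV[R]_d) : X \is unitarymx ->
    (forall i, 0 <= w 0 i) /\ \sum_i w 0 i = 1 -> f (X ^t* *m realdiag w *m X) = phi w.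
  move=> Xu /(density_unitary_diagP _ Xu) /fE ->.
  by have [p ->] := eigvals_unitary_diag w Xu; rewrite phisym.
pose simplex (w : 'rV[R]_d) := (forall i, 0 <= w 0 i) /\ \sum_i w 0 i = 1.
have xs : simplex x by apply/(density_unitary_diagP _ Uu); rewrite -rhoE.
have ys : simplex y by apply/(density_unitary_diagP _ Vu); rewrite -sigmaE.
(* Concavity of [f] on diagonal density matrices is concavity of [phi] on the simplex. *)
have phiconc t u v : 0 <= t <= 1 -> simplex u -> simplex v ->
    simplex (t *: u + (1 - t) *: v) /\
    t * phi u + (1 - t) * phi v <= phi (t *: u + (1 - t) *: v).
  move=> /[dup] t01 /andP[t0 t1] us vs.
  have ws : simplex (t *: u + (1 - t) *: v).
    case: us vs => [u0 u1] [v0 v1]; split=> [i|].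
      by rewrite !mxE addr_ge0 // mulr_ge0 // subr_ge0.
    under eq_bigr do rewrite !mxE.
    by rewrite big_split /= -!mulr_sumr u1 v1 !mulr1 addrC subrK.
  split=> //.
  have I1 : (1%:M : 'M[R[i]]_d) \is unitarymx.
    by apply/unitarymxP; rewrite trmx1 map_mx1 mulmx1.
  have diagE w : realdiag w = 1%:M ^t* *m realdiag w *m 1%:M :> 'M[R[i]]_d.
    by rewrite trmx1 map_mx1 mul1mx mulmx1.
  have dens w : simplex w -> density (realdiag w).
    by rewrite diagE => /(density_unitary_diagP _ I1).
  have fdiag w : simplex w -> f (realdiag w) = phi w.
    by move=> sw; rewrite diagE fphi.
  have := fconc _ _ t (dens _ us) (dens _ vs) t01.
  have -> : t%:C *: realdiag u + (1 - t)%:C *: realdiag v =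
      realdiag (t *: u + (1 - t) *: v).
    apply/matrixP => i j; rewrite !mxE !mulrnAr -mulrnDl.
    by rewrite -!rmorphM -rmorphD.
  by rewrite !fdiag.
(* The simplex condition is part of [Q] because [f] is known to agree with [phi] only on density
   matrices; the hull argument thereby also shows that the boxplus is one. *)
pose Q w := simplex w /\ a * f rho + (1 - a) * f sigma <= phi w.
have [zs] : Q z; last by rewrite tauE fphi.
have simplex_le1 w : simplex w -> forall i, 0 <= w 0 i <= 1.
  move=> [w0 w1] i; rewrite w0 -w1 (bigD1 i) //= lerDl sumr_ge0 //.
have maj : majorized z (a *: x + (1 - a) *: y).
  apply: (boxplus_majorized Uu Vu Wu xdec ydec _ _ ha).
  - exact: simplex_le1.
  - exact: simplex_le1.
  - by rewrite -rhoE -sigmaE.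
apply: (majorized_hull _ _ zdec maj); last first.
- by rewrite /Q rhoE sigmaE !fphi //; apply: phiconc.
- move=> t u v t01 [us fu] [vs fv]; have [ws phiw] := phiconc t u v t01 us vs.
  split=> //; apply: le_trans phiw; have /andP[t0 t1] := t01.
  (* The common lower bound [c] is written as [t c + (1 - t) c]. *)
  rewrite -[leLHS]mul1r -[X in X * _](subrK t) addrC mulrDl.
  by rewrite lerD // ler_wpM2l // subr_ge0.
- move=> p w [[w0 w1] fw]; split; last by rewrite phisym.
  split=> [i|]; first by rewrite mxE.
  by rewrite -w1 [RHS](reindex_inj (@perm_inj _ p)); apply: eq_bigr => i _; rewrite mxE.
Qed.
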